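(* Let $(\Omega,\mathcal{F},\mathbb{P})$ be a probability space, let $\mu:[a,b]\to\mathbb{R}$ be a continuous threshold function, and let $u:[a,b]\times\Omega\to\mathbb{R}$ be a random field over $(\Omega,\mathcal{F},\mathbb{P})$ such that for $\mathbb{P}$-almost all $\omega\in\Omega$ the function $u(\cdot,\omega):[a,b]\to\mathbb{R}$ is continuous. Assume that the following three conditions hold. (A1) For every $x\in[a,b]$ we have $\mathbb{P}\{u(x)=\mu(x)\}=0$. (A2) $\mathbb{P}\{u-\mu \text{ has a double zero in } [a,b]\}=0$. (A3) For $\sigma\in\{\pm1\}$, $x\in[a,b]$ and $\delta>0$ with $x+\delta\in[a,b]$ define $$p_\sigma(x,\delta)=\mathbb{P}\Bigl\{\sigma u(x)\ge\sigma\mu(x),\ \sigma u\bigl(x+\tfrac{\delta}{2}\bigr)\le\sigma\mu\bigl(x+\tfrac{\delta}{2}\bigr),\ \sigma u(x+\delta)\ge\sigma\mu(x+\delta)\Bigr\}.$$ Then there exist a continuously differentiable function $\mathcal{C}_0:[a,b]\to\mathbb{R}^+$ and a constant $\mathcal{C}_1>0$ such that for all $x\in[a,b]$ and $\delta>0$ with $x+\delta\in[a,b]$, $$p_{+1}(x,\delta)+p_{-1}(x,\delta)\le\mathcal{C}_0(x)\cdot\delta^3+\mathcal{C}_1\cdot\delta^4.$$ For each $M\in\mathbb{N}$ choose the sampling points $a=x_0<\cdots<x_M=b$ such that $$\int_{x_{k-1}}^{x_k}\sqrt[3]{\mathcal{C}_0(x)}\,dx=\frac1M\cdot\int_a^b\sqrt[3]{\mathcal{C}_0(x)}\,dx\qquad\text{for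 all }k=1,\ldots,M,$$ and let $N_\mu^\pm(\omega)$ denote the generalized nodal domains of $u(\cdot,\omega)$ and $Q_{\mu,M}^\pm(\omega)$ their cubical approximations based on these sampling points. Then, as $M\to\infty$, $$\mathbb{P}\{\beta_0(N_\mu^\pm)=\beta_0(Q_{\mu,M}^\pm)\}\ \ge\ 1-\frac{4}{3M^2}\cdot\left(\int_a^b\sqrt[3]{\mathcal{C}_0(x)}\,dx\right)^3+O\left(\frac1{M^3}\right).$$
   Context: $[a,b]\subset\mathbb{R}$ is a compact interval and $\mathbb{R}^+$ denotes the (strictly) positive reals. For $X\subset[a,b]$, $\beta_0(X)$ denotes the number of connected components of $X$. For a function $u:[a,b]\to\mathbb{R}$ and threshold $\mu:[a,b]\to\mathbb{R}$, the generalized nodal domains of $u$ are $$N_\mu^\pm=\{x\in[a,b]:\ \pm(u(x)-\mu(x))\ge0\}.$$ Given grid points $a=x_0<x_1<\cdots<x_M=b$, set $x_{M+1}=x_M=b$. The cubical approximations of $N_\mu^\pm$ are $$Q_{\mu,M}^\pm=\bigcup\{[x_k,x_{k+1}]:\ \pm\bigl((u-\mu)(x_k)\bigr)\ge0,\ k=0,\ldots,M\}.$$ The event $\{\beta_0(N_\mu^\pm)=\beta_0(Q_{\mu,M}^\pm)\}$ is the event that the equality holds for both choices of the sign. A zero $x$ of a continuous function $f$ is called a double zero if it is not the case that $f$ attains both positive and negative values in every neighborhood of $x$. *)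

(* Defs.v *)
From HB Require Import structures.
From mathcomp Require Import all_boot all_order all_algebra.
From mathcomp Require Import all_classical all_reals all_analysis.

Set Implicit Arguments.
Unset Strict Implicit.
Unset Printing Implicit Defensive.

Import Order.TTheory GRing.Theory Num.Theory.
Import numFieldNormedType.Exports.

Local Open Scope classical_set_scope.
Local Open Scope ring_scope.

(* Functions on [a, b] are represented by total functions R -> R (or
   R -> T -> R for random fields); only their values on [a, b] are used. *)

Definition components (R : realType) (X : set R) : set (set R) :=
  [set connected_component X x | x in X].

(* +oo when there are infinitely many components *)
Definition beta0 (R : realType) (X : set R) : \bar R := counting (components X).

(* The sign +/- is passed as a real number s, used at s = 1 and s = -1. *)
Definition nodal_domain (R : realType) (a b : R) (u mu : R -> R) (s : R) :
    set R :=
  [set x | x \in `[a, b] /\ 0 <= s * (u x - mu x)].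

(* [minn k.+1 M] encodes the convention x_{M+1} = x_M. *)
Definition cubical_approx (R : realType) (u mu : R -> R) (M : nat)
    (x : nat -> R) (s : R) : set R :=
  \bigcup_(k in [set k : nat | (k <= M)%N /\ 0 <= s * (u (x k) - mu (x k))])
    `[x k, x (minn k.+1 M)]%classic.

Definition double_zero (R : realType) (a b : R) (f : R -> R) (x : R) : Prop :=
  [/\ x \in `[a, b], f x = 0
    & ~ (forall V, nbhs x V ->
          (exists y, [/\ V y, y \in `[a, b] & 0 < f y]) /\
          (exists y, [/\ V y, y \in `[a, b] & f y < 0]))].

(* The difference quotients are taken within [a, b], so that the derivatives
   at a and b are one-sided. *)
Definition continuously_differentiable_on (R : realType) (a b : R)
    (f : R -> R) : Prop :=
  exists f' : R -> R,
    {within `[a, b], continuous f'} /\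
    forall x, x \in `[a, b] ->
      (f y - f x) / (y - x) @[y --> within `[a, b]%classic (x^')] --> f' x.

Definition random_field (d : measure_display) (T : measurableType d)
    (R : realType) (a b : R) (u : R -> T -> R) : Prop :=
  forall x, x \in `[a, b] -> measurable_fun setT (u x).

Definition crossover_prob (d : measure_display) (T : measurableType d)
    (R : realType) (P : probability T R) (u : R -> T -> R) (mu : R -> R)
    (s x delta : R) : \bar R :=
  P [set w | [/\ s * mu x <= s * u x w,
                 s * u (x + delta / 2) w <= s * mu (x + delta / 2)
               & s * mu (x + delta) <= s * u (x + delta) w]].

(* A belongs to the P-completion of the sigma-algebra, and its probability
   under the completed measure is p. *)
Definition has_completed_prob (d : measure_display) (T : measurableType d)
    (R : realType) (P : probability T R) (A : set T) (p : \bar R) : Prop :=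
  exists B : set T,
    [/\ measurable B, P.-negligible (A `+` B) & P B = p].

Definition cbrt_integral (R : realType) (C0 : R -> R) (a b : R) : R :=
  \int[@lebesgue_measure R]_(x in `[a, b]) (C0 x `^ 3^-1).

Definition is_grid (R : realType) (a b : R) (M : nat) (x : nat -> R) : Prop :=
  [/\ x 0%N = a, x M = b & forall k, (k < M)%N -> x k < x k.+1].

(* Main.v *)
Require Import Defs.
From HB Require Import structures.
From mathcomp Require Import all_boot all_order all_algebra.
From mathcomp Require Import all_classical all_reals all_analysis.
From mathcomp Require Import measurable_realfun ring lra zify.
Import Order.TTheory GRing.Theory Num.Theory.
Import numFieldNormedType.Exports.
Set Implicit Arguments.
Unset Strict Implicit.
Unset Printing Implicit Defensive.
Local Open Scope classical_set_scope.
Local Open Scope ring_scope.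

(** Fix a path and write [f = u - mu]. The components of a subset [S] of the
    line are counted by alternations: [S] has at least [m + 1] components iff
    there are points [x_0 < y_1 < x_1 < ... < y_m < x_m] with every [x_i] in
    [S] and every [y_i] outside [S]. So [beta0 S] is determined by the lengths
    of the alternations of [S] ([beta0_eq]), and the two Betti numbers can be
    compared by moving points, without a description of the components.

    Let [D] consist of all dyadic subdivision points of all grid cells. Almost
    surely [f] is continuous, has no double zero and vanishes nowhere on [D].
    Alternations of the nodal domain can then be moved into [D], with strict
    signs of [f]: a zero which is not a double zero has points of both signs
    nearby, so it may be replaced by a point of [D] with the desired strict
    sign ([nodal_domain_samples]). Alternations of the cubical approximation
    can be moved to the grid ([cubical_approx_grid]). Up to a null set, the
    event in the theorem therefore says that the signs of [f] on [D] and on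
    the grid have alternations of the same lengths. This involves countably
    many random variables, so it is measurable
    ([measurable_samples_agree_grid]).

    Suppose that no dyadic subinterval of a cell shows a double crossover,
    i.e. the sign pattern + - + or - + - at its end points and its midpoint.
    Then each midpoint has the sign of one of its two neighbours, so the signs
    on a dyadic level are the signs on the previous level, pulled back along a
    monotone map. Hence the sign changes at most once in a cell
    ([dyadic_convex]); moving each point of [D] to an end point of its cell
    with the same sign preserves alternations, and the Betti numbers agree
    ([samples_grid]).

    It remains to bound the probability of a double crossover. By [A3] and the
    union bound, for a cell [[p, p + h]] it is at most the sum over [n] of
    [2 ^ n * c * (h / 2 ^ n) ^ 3], which is [4 / 3 * c * h ^ 3], where
    [c = C0 p + O(h)] because [C0] is Lipschitz ([double_crossover_prob]).
    With [I] the integral of the cube root of [C0], every cell contributes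
    [I / M] to [I], which forces [h = O(1 / M)] and
    [C0 p * h ^ 3 <= (I / M) ^ 3 + O(1 / M ^ 4)] ([cell_estimates]). The sum
    over the [M] cells is at most [4 / 3 * I ^ 3 / M ^ 2 + O(1 / M ^ 3)]
    ([some_crossover_prob]). *)

(** * Alternations and the number of components *)

Section Alternation.
Variable R : realType.
Implicit Types (P Q S : R -> Prop) (x y z : R).

(** Chains [x < y_1 < z_1 < ... < y_m < z_m] with [x, z_i] in [P] and [y_i] in
    [Q]. They begin and end in [P], so that each [y_i] lies between points of
    [P]. *)
Fixpoint alternates_from (m : nat) (P Q : R -> Prop) (x : R) : Prop :=
  P x /\
  if m is m'.+1 then
    exists y z, [/\ x < y, y < z, Q y & alternates_from m' P Q z]
  else True.

Definition alternates (m : nat) (P Q : R -> Prop) : Prop :=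
  exists x, alternates_from m P Q x.

Lemma alternates_from_head m P Q x : alternates_from m P Q x -> P x.
Proof. by case: m => [|m] []. Qed.

(** Points of a chain may be moved independently as long as the order between
    neighbours, which are of different kinds, is kept. The relations [rP] and
    [rQ] stand for the choice of the new point. A point of [Q] only has to be
    moved if it lies between two points of [P]. *)
Lemma alternates_transfer P Q P' Q' (rP rQ : R -> R -> Prop) :
  (forall x, P x -> exists2 x', P' x' & rP x x') ->
  (forall x y z, P x -> Q y -> P z -> x < y -> y < z ->
     exists2 y', Q' y' & rQ y y') ->
  (forall x x' y y', P x -> P' x' -> Q y -> Q' y' -> rP x x' -> rQ y y' ->
     (x < y -> x' < y') /\ (y < x -> y' < x')) ->
  forall m, alternates m P Q -> alternates m P' Q'.
Proof.
move=> toP toQ mono.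
have step m x x' : P x -> P' x' -> rP x x' ->
    alternates_from m P Q x -> alternates_from m P' Q' x'.
  elim: m x x' => [|m IH] x x' Px P'x' r /= [_]; first by [].
  move=> [y [z [xy yz Qy chain]]]; split=> //.
  have Pz := alternates_from_head chain.
  have [y' Q'y' ry] := toQ _ _ _ Px Qy Pz xy yz.
  have [z' P'z' rz] := toP _ Pz.
  have [lt_x _] := mono _ _ _ _ Px P'x' Qy Q'y' r ry.
  have [_ lt_z] := mono _ _ _ _ Pz P'z' Qy Q'y' rz ry.
  by exists y', z'; split; [exact: lt_x|exact: lt_z|by []|exact: IH chain].
move=> m [x chain]; have Px := alternates_from_head chain.
by have [x' P'x' r] := toP _ Px; exists x'; exact: step chain.
Qed.

Lemma alternates_sub P Q P' Q' : (forall x, P x -> P' x) ->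
  (forall x, Q x -> Q' x) -> forall m, alternates m P Q -> alternates m P' Q'.
Proof.
move=> PP' QQ'; apply: (@alternates_transfer _ _ _ _ eq eq) => //.
- by move=> x /PP' ?; exists x.
- by move=> x y z _ /QQ' ? _ _ _; exists y.
- by move=> x x' y y' _ _ _ _ <- <-.
Qed.

End Alternation.

Section Components.
Variable R : realType.
Implicit Types (S : set R) (x y z : R).

Lemma same_component S x y : x <= y -> S x -> S y ->
  connected_component S x = connected_component S y <->
  `[x, y]%classic `<=` S.
Proof.
move=> xy Sx Sy; split=> [eqxy z /= |sub].
  rewrite in_itv /= => xzy.
  apply: (@connected_component_sub _ S x).
  have/connected_intervalP := @component_connected _ S x.
  apply; last exact: xzy; first exact: connected_component_refl.
  by rewrite eqxy; exact: connected_component_refl.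
apply: same_connected_component.
apply: (@connected_component_max _ S `[x, y]%classic x) => //.
- by rewrite /= in_itv /= lexx.
- exact: segment_connected.
- by rewrite /= in_itv /= lexx xy.
Qed.

(** Connected subsets of the line are intervals, so two points belong to
    different components iff a point between them is missing. *)
Lemma component_gap S x y : x < y -> S x -> S y ->
  connected_component S x <> connected_component S y <->
  exists z, [/\ x < z, z < y & ~ S z].
Proof.
move=> xy Sx Sy; rewrite (same_component (ltW xy) Sx Sy).
split=> [/existsNP[z] /not_implyP[]|[z [xz zy NSz]]].
  rewrite /= in_itv /= !le_eqVlt => /andP[/predU1P[<-|xz] /predU1P[->|zy]] // NSz.
  by exists z.
by move=> /(_ z); rewrite /= in_itv /= !ltW// => /(_ isT).
Qed.

Lemma alternates_from_components m S x :
  alternates_from m S (~` S) x ->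
  exists s : seq R,
    [/\ size s = m.+1, (forall y, y \in s -> x <= y /\ S y) &
        uniq (map (connected_component S) s)].
Proof.
elim: m x => [|m IH] x /= [Sx].
  by move=> _; exists [:: x]; split => // y; rewrite inE => /eqP ->.
move=> [y [z [xy yz NSy chain]]]; have [s [sz sS us]] := IH _ chain.
exists (x :: s); split.
- by rewrite /= sz.
- move=> w; rewrite inE => /predU1P[->//|/sS[zw Sw]].
  by split => //; rewrite (le_trans _ zw)// (le_trans (ltW xy) (ltW yz)).
- rewrite /= us andbT; apply/negP => /mapP[w /sS[zw Sw]].
  apply/component_gap => //; first by rewrite (lt_le_trans (lt_trans xy yz)).
  by exists y; split => //; exact: lt_le_trans zw.
Qed.

(** Sorted representatives of distinct components: a gap of [S] separates any
    two neighbours. *)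
Lemma components_alternates_from S x (s : seq R) :
  sorted <=%R (x :: s) ->
  (forall y, y \in x :: s -> S y) ->
  uniq (map (connected_component S) (x :: s)) ->
  alternates_from (size s) S (~` S) x.
Proof.
elim: s x => [|z s IH] x /=.
  by move=> _ inS _; split=> //; apply: inS; rewrite inE eqxx.
move=> /andP[xz srt] inS /andP[]; rewrite inE negb_or => /andP[/eqP neq _] us.
have Sx : S x by apply: inS; rewrite inE eqxx.
have Sz : S z by apply: inS; rewrite !inE eqxx orbT.
split=> //.
have lt_xz : x < z by rewrite lt_neqAle xz andbT; apply: contra_notN neq => /eqP ->.
have [y [xy yz NSy]] := (component_gap lt_xz Sx Sz).1 neq.
exists y, z; split => //; apply: IH => // w ws; apply: inS.
by rewrite inE ws orbT.
Qed.

Lemma alternates_components m S :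
  alternates m S (~` S) <->
  exists c : seq (set R),
    [/\ size c = m.+1, uniq c & forall X, X \in c -> components S X].
Proof.
split=> [[x /alternates_from_components[s [sz sS us]]]|[c [sz uc cS]]].
  exists (map (connected_component S) s); rewrite size_map; split=> // X.
  by move=> /mapP[y /sS[_ Sy] ->]; exists y.
have {cS} [s0 s0S cE] : exists2 s0, (forall y, y \in s0 -> S y) &
    c = map (connected_component S) s0.
  elim: c {sz uc} cS => [|X c IH] cS; first by exists [::].
  have [y Sy <-] := cS X (mem_head _ _).
  have [|s sS ->] := IH; first by move=> Y Yc; apply: cS; rewrite inE Yc orbT.
  by exists (y :: s) => // w; rewrite inE => /predU1P[->|/sS].
have perm := permEl (perm_sort <=%R s0).
move: sz uc; rewrite cE -(perm_uniq (perm_map _ perm)) size_map -(perm_size perm).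
have sS : forall y, y \in sort <=%R s0 -> S y.
  by move=> y; rewrite mem_sort; exact: s0S.
have srt : sorted <=%R (sort <=%R s0) by apply: sort_sorted; exact: le_total.
case: (sort _ _) srt sS => [|x s] //= srt sS [<-] us.
by exists x; exact: components_alternates_from.
Qed.

Lemma counting_ge (T : choiceType) (A : set T) (n : nat) :
  (n%:R%:E <= counting A :> \bar R)%E <->
  exists c : seq T, [/\ size c = n, uniq c & forall X, X \in c -> A X].
Proof.
rewrite /counting; case: asboolP => [finA|infA].
  rewrite lee_fin ler_nat; split=> [le_n|[c [<- uc cA]]].
    exists (take n (finmap.enum_fset (fset_set A))); split.
    - by rewrite size_takel.
    - by rewrite take_uniq.
    - by move=> X /mem_take; rewrite in_fset_set// inE.
  apply: uniq_leq_size => // X /cA AX; by rewrite in_fset_set// inE.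
rewrite leey; split=> // _.
have [B BA cardB] := infinite_set_fset n infA.
exists (take n (finmap.enum_fset B)); split; first by rewrite size_takel.
- by rewrite take_uniq.
- by move=> X /mem_take XB; exact: BA.
Qed.

(** Natural numbers and [+oo] are determined by the positive integers below
    them; this treats finite and infinite sets alike. *)
Lemma counting_eq (T T' : choiceType) (A : set T) (B : set T') :
  (forall n : nat, (n.+1%:R%:E <= counting A :> \bar R)%E <->
                   (n.+1%:R%:E <= counting B :> \bar R)%E) ->
  counting A = counting B :> \bar R.
Proof.
rewrite /counting => le_iff.
have not_ge (k n : nat) : (n.+1%:R%:E <= k%:R%:E :> \bar R)%E -> (n < k)%N.
  by rewrite lee_fin ler_nat.
case: asboolP le_iff => finA; case: asboolP => finB le_iff //.
- move: (size (finmap.enum_fset (fset_set A))) le_iff => p.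
  move: (size (finmap.enum_fset (fset_set B))) => q le_iff.
  congr ((_%:R)%:E); apply/eqP; rewrite eqn_leq; apply/andP; split.
  + case: p le_iff => // p le_iff.
    by have /(_ (lexx _)) := (le_iff p).1; rewrite lee_fin ler_nat.
  + case: q le_iff => // q le_iff.
    by have /(_ (lexx _)) := (le_iff q).2; rewrite lee_fin ler_nat.
- have := (le_iff (size (finmap.enum_fset (fset_set A)))).2 (leey _).
  by move=> /not_ge; rewrite ltnn.
- have := (le_iff (size (finmap.enum_fset (fset_set B)))).1 (leey _).
  by move=> /not_ge; rewrite ltnn.
Qed.

Lemma beta0_eq S S' :
  beta0 S = beta0 S' <->
  forall m, alternates m S (~` S) <-> alternates m S' (~` S').
Proof.
have beta0_ge m (A : set R) :
    (m.+1%:R%:E <= beta0 A)%E <-> alternates m A (~` A).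
  by rewrite alternates_components; exact: counting_ge.
split=> [eqSS' m|eqalt]; first by rewrite -!beta0_ge eqSS'.
by apply: counting_eq => n; rewrite !beta0_ge.
Qed.
End Components.

(** * Moving alternations of nodal domains and cubical approximations *)

Section Densification.
Variables (R : realType) (a b : R) (g : R -> R) (D : set R).
Hypothesis gcont : {within `[a, b], continuous g}.
Hypothesis Dab : forall q, D q -> q \in `[a, b].
Hypothesis Ddense : forall y l r, y \in `[a, b] -> l < y -> y < r ->
  exists q, [/\ D q, l < q & q < r].
Hypothesis crossing : forall y l r, y \in `[a, b] -> g y = 0 ->
  l < y -> y < r -> exists z, [/\ z \in `[a, b], l < z, z < r & 0 < g z].

Lemma pos_nearby (h : R -> R) y : {within `[a, b], continuous h} ->
  y \in `[a, b] -> 0 < h y ->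
  exists2 e, 0 < e & forall z, z \in `[a, b] -> `|y - z| < e -> 0 < h z.
Proof.
move=> /subspace_continuousP hcont yab hy.
have /= := hcont y yab.
move=> /cvgrPdist_lt /(_ _ hy); rewrite near_withinE.
move=> /nbhs_ballP[e /= e0 He]; exists e => // z zab yz.
by have := He z yz zab; rewrite ltr_norml gtrBl => /andP[_].
Qed.

Lemma dense_pos (h : R -> R) y l r : {within `[a, b], continuous h} ->
  y \in `[a, b] -> 0 < h y -> l < y -> y < r ->
  exists q, [/\ D q, l < q, q < r & 0 < h q].
Proof.
move=> hcont yab hy ly yr; have [e e0 He] := pos_nearby hcont yab hy.
have [||q [Dq lq qr]] := @Ddense y (Num.max l (y - e)) (Num.min r (y + e)) yab.
- by rewrite gt_max ly/=; lra.
- by rewrite lt_min yr/=; lra.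
move: lq qr; rewrite gt_max lt_min => /andP[lq eq] /andP[qr qe].
exists q; split => //; apply: He; first exact: Dab.
by rewrite ltr_norml; apply/andP; split; lra.
Qed.

Let N : set R := [set x | x \in `[a, b] /\ 0 <= g x].

(** The points of the chain are moved from left to right. The bound [l] is the
    previously moved point, which the rest of the chain has to stay above. *)
Lemma alternates_nodal_from m l x : l < x -> alternates_from m N (~` N) x ->
  exists2 q, l < q &
    alternates_from m (fun q => D q /\ 0 < g q) (fun q => D q /\ g q < 0) q.
Proof.
have NgC : {within `[a, b], continuous (fun y => - g y)}.
  by move=> y; apply: continuousN; exact: gcont.
have pos l' x' r' : N x' -> l' < x' -> x' < r' ->
    exists q, [/\ D q, l' < q, q < r' & 0 < g q].
  move=> [xab]; rewrite le_eqVlt => /predU1P[/esym gx|gx] lx xr.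
    have [z [zab lz zr gz]] := crossing xab gx lx xr.
    exact: (dense_pos gcont zab gz lz zr).
  exact: (dense_pos gcont xab gx lx xr).
elim: m l x => [|m IH] l x lx /= [Nx].
  move=> _; have [q [Dq lq _ gq]] := pos _ _ (x + 1) Nx lx (ltr_pwDr ltr01 (lexx x)).
  by exists q.
move=> [y [z [xy yz NNy chain]]].
have [zab _] := alternates_from_head chain.
have yab : y \in `[a, b].
  move: Nx.1 zab; rewrite !in_itv/= => /andP[? ?] /andP[? ?].
  by apply/andP; split; lra.
have gy : 0 < - g y by rewrite oppr_gt0 ltNge; apply: contra_notN NNy => gy.
have [y' [Dy' xy' y'z gy']] := dense_pos NgC yab gy xy yz.
have [z' y'z' chain'] := IH _ _ y'z chain.
have [q [Dq lq qy' gq]] := pos _ _ _ Nx lx xy'.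
exists q => //; split=> //; exists y', z'; split=> //; split=> //.
by rewrite -oppr_gt0.
Qed.

Lemma alternates_nodal m :
  alternates m N (~` N) <->
  alternates m (fun q => D q /\ 0 < g q) (fun q => D q /\ g q < 0).
Proof.
split=> [[x chain]|].
  have x1 : x - 1 < x by lra.
  by have [q _ ?] := alternates_nodal_from x1 chain; exists q.
apply: alternates_sub => x [Dx gx]; first by split; [exact: Dab|exact: ltW].
by move=> [_]; rewrite leNgt gx.
Qed.

End Densification.

Section Grids.
Variables (R : realType) (a b : R) (M : nat) (x : nat -> R).
Hypothesis xgrid : is_grid a b M x.

Lemma grid_lt i j : (i <= M)%N -> (j <= M)%N -> (x i < x j) = (i < j)%N.
Proof.
have [_ _ xS] := xgrid.
have lt i' j' : (i' < j')%N -> (j' <= M)%N -> x i' < x j'.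
  elim: j' => // j' IH; rewrite ltnS leq_eqVlt => /predU1P[->|ij] jM.
    exact: xS.
  by apply: lt_trans (xS _ jM); apply: IH => //; exact: ltnW.
move=> iM jM; case: (ltnP i j) => [ij|]; first exact: lt.
rewrite leq_eqVlt => /predU1P[->|ji]; first exact: ltxx.
by apply/negbTE; rewrite -leNgt ltW// lt.
Qed.

Lemma grid_le i j : (i <= M)%N -> (j <= M)%N -> (x i <= x j) = (i <= j)%N.
Proof. by move=> iM jM; rewrite leNgt grid_lt// -leqNgt. Qed.

Lemma grid_in k : (k <= M)%N -> x k \in `[a, b].
Proof.
have [xa xb _] := xgrid => kM.
by rewrite in_itv/= -{1}xa -xb !grid_le// leqnn kM.
Qed.

Lemma grid_cell y : a <= y -> y < b ->
  exists j, [/\ (j < M)%N, x j <= y & y < x j.+1].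
Proof.
have [xa xb _] := xgrid => ay yb.
have : forall n, (n <= M)%N -> y < x n ->
    exists j, [/\ (j < M)%N, x j <= y & y < x j.+1].
  elim=> [|n IH] nM; first by rewrite xa ltNge ay.
  by have [yn _|ny yn] := ltP y (x n); [exact: IH (ltnW nM) yn|exists n].
by apply; first exact: leqnn; rewrite xb.
Qed.

(** A point of [Q] is moved to the left end of a cell that puts it into [Q], a
    point outside [Q] to the left end of its own cell; the signs there differ,
    so the two left ends are distinct and in the right order. Conversely, a
    grid point where [g < 0] may still belong to [Q], as the right end of a
    cell, and is moved to the midpoint of the cell that starts at it. *)
Lemma alternates_cubical (g : R -> R) m :
  let Q := \bigcup_(k in [set k : nat | (k <= M)%N /\ 0 <= g (x k)])
    `[x k, x (minn k.+1 M)]%classic in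
  alternates m Q (~` Q) <->
  alternates m (fun q => exists k, [/\ (k <= M)%N, q = x k & 0 <= g q])
               (fun q => exists k, [/\ (k <= M)%N, q = x k & g q < 0]).
Proof.
have [xa xb _] := xgrid.
move=> Q; split.
  apply: (@alternates_transfer _ _ _ _ _
    (fun p q => exists k, [/\ (k <= M)%N, q = x k, x k <= p & p <= x (minn k.+1 M)])
    (fun p q => exists k, [/\ (k < M)%N, q = x k, x k <= p & p < x k.+1])).
  - move=> p [k [kM gk]]; rewrite /= in_itv/= => /andP[kp pk].
    by exists (x k); exists k.
  (* [y] lies between points of [Q], hence in some cell, and [g] is negative
     at the left end of that cell since [y] does not belong to [Q] *)
  - move=> p y r [k [kM gk]] + NQy [l [lM gl]] +.
    rewrite /= !in_itv/= => /andP[kp pk] /andP[lr rl] py yr.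
    have ay : a <= y.
      by rewrite -xa (le_trans _ (ltW py))// (le_trans _ kp)// grid_le.
    have yb : y < b by rewrite (lt_le_trans yr)// (le_trans rl)// -xb grid_le// geq_minr.
    have [j [jM jy yj]] := grid_cell ay yb; exists (x j); last by exists j.
    exists j; split=> //; first exact: ltnW.
    rewrite ltNge; apply: contra_notN NQy => gj; exists j.
      by split=> //; exact: ltnW.
    by rewrite /= in_itv/= jy/= (minn_idPl jM) ltW.
  - move=> p p' y y' _ [k0 [_ _ gp]] _ [j0 [_ _ gy]].
    move=> [k [kM p'E kp pk]] [j [jM y'E jy yj]].
    have kj : k != j by apply: contraTneq gy => kj; rewrite -leNgt y'E -kj -p'E.
    rewrite p'E y'E !grid_lt//; try exact: ltnW.
    split=> [py|yp].
      have : x k < x j.+1 by lra.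
      by rewrite grid_lt// ltnS ltn_neqAle kj.
    have : x j < x (minn k.+1 M) by lra.
    rewrite grid_lt// ?geq_minr//; last exact: ltnW.
    by rewrite leq_min ltnS => /andP[+ _]; rewrite leq_eqVlt eq_sym (negbTE kj).
apply: (@alternates_transfer _ _ _ _ _ eq
  (fun y y' => exists j, [/\ (j < M)%N, y = x j, x j < y' & y' < x j.+1])).
- move=> p [k [kM -> gk]]; exists (x k) => //; exists k => //=.
  by rewrite in_itv/= lexx grid_le// ?geq_minr// leq_min leqnSn kM.
- move=> p y r [k [kM -> gk]] [j [jM -> gj]] [l [lM -> gl]] _.
  rewrite grid_lt// => jl.
  have jM' : (j < M)%N by exact: leq_trans lM.
  have xj : x j < x j.+1 by rewrite grid_lt.
  (* the closed cells that form [Q] meet the open [j]-th cell only if they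
     are equal to it *)
  exists ((x j + x j.+1) / 2); last by exists j; split=> //; lra.
  move=> [i [iM gi]]; rewrite /= in_itv/= => /andP[ij ji].
  suff ijE : i = j by move: gi; rewrite ijE leNgt gj.
  apply/eqP; rewrite eqn_leq -ltnS -(@grid_lt i j.+1)// -ltnS; apply/andP; split.
    by lra.
  have : x j < x (minn i.+1 M) by lra.
  by rewrite grid_lt ?geq_minr// leq_min => /andP[].
- move=> p p' y y' [k [kM -> _]] _ _ _ <- [j [jM -> jy yj]].
  split=> [|jk]; first by move=> kj; exact: lt_trans jy.
  rewrite (lt_le_trans yj)// grid_le//.
  by rewrite grid_lt// in jk; exact: ltnW.
Qed.

(** The convexity hypothesis says that the sign of [g] changes at most once
    along the points of a cell. Each of them is moved to an end point of its
    cell with the same sign; if two points of one cell have opposite signs,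
    then these are the signs of the end points, in the same order. *)
Lemma alternates_grid (g : R -> R) (Dk : nat -> set R) m :
  (forall k q, (k < M)%N -> Dk k q -> x k <= q /\ q <= x k.+1) ->
  (forall k, (k < M)%N -> Dk k (x k) /\ Dk k (x k.+1)) ->
  (forall k q, (k < M)%N -> Dk k q -> g q != 0) ->
  (forall k p q r, (k < M)%N -> Dk k p -> Dk k q -> Dk k r -> p <= q -> q <= r ->
     (0 < g p) = (0 < g r) -> (0 < g q) = (0 < g p)) ->
  (0 < M)%N ->
  let D := \bigcup_(k in [set k | (k < M)%N]) Dk k in
  alternates m (fun q => D q /\ 0 < g q) (fun q => D q /\ g q < 0) <->
  alternates m (fun q => exists k, [/\ (k <= M)%N, q = x k & 0 <= g q])
               (fun q => exists k, [/\ (k <= M)%N, q = x k & g q < 0]).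
Proof.
move=> Dcell Dends gN0 conv M0 D; split; last first.
  have Dgrid k : (k <= M)%N -> D (x k).
    rewrite leq_eqVlt => /predU1P[->|kM]; last by exists k => //; exact: (Dends _ kM).1.
    exists M.-1; rewrite /= ?prednK//.
    by have := Dends M.-1; rewrite prednK// leqnn => /(_ isT)[].
  apply: alternates_sub => y [k [kM -> gk]]; split=> //; try exact: Dgrid.
  have [l lM Dl] := Dgrid _ kM.
  by rewrite lt_neqAle gk eq_sym (gN0 _ _ lM Dl).
have sgN y y' : 0 < g y -> g y' < 0 -> (0 < g y) <> (0 < g y').
  by move=> -> gy'; rewrite ltNge ltW.
(* [q] is an end point of a cell of [p], with the sign of [p] *)
pose rel p q := exists k, [/\ (k < M)%N, Dk k p, q = x k \/ q = x k.+1
  & (0 < g q) = (0 < g p)].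
have relE p : D p -> exists q, rel p q.
  move=> [k kM Dp]; have [Dx Dx'] := Dends _ kM; have [xp px'] := Dcell _ _ kM Dp.
  have [e|e] := eqVneq (0 < g (x k)) (0 < g p).
    by exists (x k); exists k; split=> //; left.
  exists (x k.+1); exists k; split=> //; first by right.
  have := conv _ _ _ _ kM Dx Dp Dx' xp px'.
  move: e; case: (0 < g p); case: (0 < g (x k)); case: (0 < g (x k.+1)) => //= _.
    by move=> /(_ erefl).
  by move=> /(_ erefl).
have relN p q : D p -> rel p q -> g q <> 0.
  move=> Dp [k [kM Dkp qE _]]; apply/eqP.
  by have [Dx Dx'] := Dends _ kM; case: qE => ->; exact: (gN0 _ _ kM).
have mono p p' q q' : p < q -> (0 < g p) <> (0 < g q) -> rel p p' -> rel q q' -> p' < q'.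
  move=> pq neq [k [kM Dp p'E p's]] [l [lM Dq q'E q's]].
  have p'q' : p' != q' by apply: contra_notN neq => /eqP pq'; rewrite -p's -q's pq'.
  rewrite lt_neqAle p'q'/=.
  have [kp pk] := Dcell _ _ kM Dp; have [lq ql] := Dcell _ _ lM Dq.
  have [kl|lk|kl] := ltngtP k l.
  - have : x k.+1 <= x l by rewrite grid_le// ltnW.
    have : x k <= x k.+1 by rewrite grid_le// ltnW.
    have : x l <= x l.+1 by rewrite grid_le// ltnW.
    by case: p'E => ->; case: q'E => ->; lra.
  - have : x l.+1 <= x k by rewrite grid_le// ltnW.
    lra.
  - have := ltW pq; move: p'E q'E => [] p'E [] q'E; rewrite p'E q'E kl ?lexx//.
      by rewrite grid_le// ltnW.
    rewrite p'E q'E -kl in p's q's *.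
    have [Dx Dx'] := Dends _ kM; rewrite -kl in Dq.
    have := conv _ _ _ _ kM Dx Dp Dq kp (ltW pq) q's.
    by move=> e; case: neq; rewrite e.
apply: (@alternates_transfer _ _ _ _ _ rel rel).
- move=> p [Dp gp]; have [q pq] := relE _ Dp; exists q => //.
  have [k [kM Dkp qE qs]] := pq.
  case: qE => qE; [exists k|exists k.+1]; split=> //; try exact: ltnW.
    by rewrite ltW// qs.
  by rewrite ltW// qs.
- move=> _ p _ _ [Dp gp] _ _ _; have [q pq] := relE _ Dp; exists q => //.
  have gq : g q < 0.
    rewrite lt_neqAle leNgt; have/eqP -> := relN _ _ Dp pq.
    by case: pq => k [_ _ _ ->]; rewrite ltNge ltW.
  by have [k [kM Dkp [] qE qs]] := pq; [exists k|exists k.+1]; split=> //; exact: ltnW.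
- move=> p p' q q' [_ gp] _ [_ gq] _ pp' qq'.
  by split=> ?; [apply: mono pp' qq'|apply: mono qq' pp'] => //;
    [|apply: nesym]; exact: sgN.
Qed.
End Grids.

(** * Signs along dyadic subdivisions *)

Section Dyadic.
Variable R : realType.

Definition dyadic (p h : R) (n j : nat) : R := p + h * (j%:R / 2 ^+ n).

Definition dyadics (p h : R) : set R :=
  [set q | exists n j, (j <= 2 ^ n)%N /\ q = dyadic p h n j].

Variables (p h : R).
Let d := dyadic p h.

Lemma dyadic_refine n k j : d (n + k) (j * 2 ^ k) = d n j.
Proof.
rewrite /d /dyadic natrM natrX exprD; congr (_ + _ * _).
by field; rewrite !expf_neq0// pnatr_eq0.
Qed.

Lemma dyadic_even n j : d n.+1 j.*2 = d n j.
Proof. by rewrite -(dyadic_refine n 1) addn1 expn1 muln2. Qed.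

(** A midpoint has the value of one of its neighbours: by hypothesis if these
    agree, and otherwise because [c] has only two values. So [c] at index [j]
    of level [n + 1] is [c] at an index between [j./2] and [uphalf j] of level
    [n]. This index is monotone in [j], hence convexity is inherited from level
    to level. *)
Lemma dyadic_convex (c : R -> bool) :
  (forall n j, (j < 2 ^ n)%N -> c (d n j) = c (d n j.+1) ->
     c (d n.+1 j.*2.+1) = c (d n j)) ->
  forall n i j k, (i <= j)%N -> (j <= k)%N -> (k <= 2 ^ n)%N ->
    c (d n i) = c (d n k) -> c (d n j) = c (d n i).
Proof.
move=> flip; elim=> [|n IH] i j k.
  rewrite expn0 => ij jk k1 ik.
  case: (leqP k 0) => k0.
    by have -> : j = i by lia.
  case: (leqP j 0) => j0; first by have -> : j = i by lia.
  by rewrite ik; have -> : j = k by lia.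
move=> ij jk k2 ik.
(* the index of level [n] from which [l] inherits its value *)
have parent l : (l <= 2 ^ n.+1)%N ->
    exists m, [/\ (l./2 <= m)%N, (m <= uphalf l)%N & c (d n.+1 l) = c (d n m)].
  move=> l2; have lE := odd_double_half l; have uE := uphalf_half l.
  have [oddl|evenl] := boolP (odd l); last first.
    exists l./2; rewrite uE (negbTE evenl) leqnn; split=> //.
    by rewrite -{1}lE (negbTE evenl) add0n dyadic_even.
  rewrite oddl /= in lE uE; rewrite add1n in uE.
  have l2n : (l./2 < 2 ^ n)%N by move: l2; rewrite expnS; lia.
  have [eqc|neqc] := eqVneq (c (d n l./2)) (c (d n l./2.+1)).
    exists l./2; rewrite uE; split=> //.
    by rewrite -[in LHS]lE; exact: flip.
  have : c (d n.+1 l) = c (d n l./2) \/ c (d n.+1 l) = c (d n l./2.+1).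
    by move: neqc; do 3! case: (c _) => //; auto.
  by case=> e; [exists l./2|exists l./2.+1]; rewrite uE; split.
case: (ltngtP i j) (ij) => // [lt_ij|->//] _.
case: (ltngtP j k) (jk) => // [lt_jk|->//] _.
have half_le l l' : (l < l')%N -> (uphalf l <= l'./2)%N.
  by move=> ll'; rewrite uphalfE; exact: half_leq.
have [i' [_ i'i ci]] := parent i (ltac:(lia)).
have [j' [jj' j'j cj]] := parent j (ltac:(lia)).
have [k' [kk' k'k ck]] := parent k k2.
rewrite cj ci; apply: (IH i' j' k').
- exact: leq_trans i'i (leq_trans (half_le _ _ lt_ij) jj').
- exact: leq_trans j'j (leq_trans (half_le _ _ lt_jk) kk').
- apply: leq_trans k'k _; rewrite uphalf_half; move: k2; rewrite expnS.
  by have := odd_double_half k; lia.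
- by rewrite -ci -ck.
Qed.

Hypothesis h0 : 0 < h.

Lemma dyadic_le n i j : (d n i <= d n j) = (i <= j)%N.
Proof.
by rewrite /d /dyadic lerD2l ler_pM2l// ler_pM2r ?ler_nat.
Qed.

Lemma dyadics_convex (c : R -> bool) :
  (forall n j, (j < 2 ^ n)%N -> c (d n j) = c (d n j.+1) ->
     c (d n.+1 j.*2.+1) = c (d n j)) ->
  forall q1 q2 q3, dyadics p h q1 -> dyadics p h q2 -> dyadics p h q3 ->
    q1 <= q2 -> q2 <= q3 -> c q1 = c q3 -> c q2 = c q1.
Proof.
move=> flip q1 q2 q3 [n1 [j1 [j1n ->]]] [n2 [j2 [j2n ->]]] [n3 [j3 [j3n ->]]].
rewrite -/d -(dyadic_refine n1 (n2 + n3)) -(dyadic_refine n2 (n1 + n3)).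
rewrite -(dyadic_refine n3 (n1 + n2)).
have -> : (n2 + (n1 + n3) = n1 + (n2 + n3))%N by lia.
have -> : (n3 + (n1 + n2) = n1 + (n2 + n3))%N by lia.
rewrite !dyadic_le => le12 le23; apply: dyadic_convex => //.
have -> : (n1 + (n2 + n3) = n3 + (n1 + n2))%N by lia.
by rewrite (expnD 2 n3) leq_mul2r j3n orbT.
Qed.

Lemma dyadics_bounds q : dyadics p h q -> p <= q /\ q <= p + h.
Proof.
move=> [n [j [jn ->]]]; split.
  by rewrite /dyadic lerDl mulr_ge0// ?ltW// divr_gt0//; rewrite ?exprn_gt0.
rewrite /dyadic lerD2l -{2}(mulr1 h) ler_pM2l// ler_pdivrMr ?exprn_gt0// mul1r.
by rewrite -natrX ler_nat.
Qed.

Lemma dyadics_ends : dyadics p h p /\ dyadics p h (p + h).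
Proof.
split; [exists 0%N, 0%N|exists 0%N, 1%N]; split=> //; rewrite /dyadic expr0 ?divr1.
  by rewrite mulr0 addr0.
by rewrite mulr1.
Qed.

Lemma dyadics_dense l y : l < y -> p <= y -> y <= p + h ->
  exists q, [/\ dyadics p h q, l < q & q <= y].
Proof.
move=> ly py yph.
(* a level whose mesh is finer than [y - l]; there [q] is the largest dyadic
   point which is at most [y] *)
pose n := (Num.truncn (h / (y - l))).+1.
have hn : h / 2 ^+ n < y - l.
  rewrite ltr_pdivrMr ?exprn_gt0// mulrC -ltr_pdivrMr ?subr_gt0//.
  have := truncnS_gt (h / (y - l)); rewrite -/n => /lt_trans; apply.
  by rewrite -natrX ltr_nat ltn_expl.
pose z := (y - p) / h * 2 ^+ n.
have z0 : 0 <= z by rewrite /z mulr_ge0 ?exprn_ge0// divr_ge0 ?subr_ge0 ?(ltW h0).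
have /andP[tz zt] := truncn_itv z0.
have yE : y = p + h * (z / 2 ^+ n).
  by rewrite /z; field; rewrite expf_neq0 ?pnatr_eq0 ?gt_eqF.
have n0 : 0 < 2 ^+ n :> R by rewrite exprn_gt0.
exists (d n (Num.truncn z)); split.
- exists n, (Num.truncn z); split=> //.
  rewrite -(ler_nat R) natrX (le_trans tz)// /z ler_piMl ?exprn_ge0//.
  by rewrite ler_pdivrMr// mul1r; lra.
- suff : y - h / 2 ^+ n < d n (Num.truncn z) by lra.
  rewrite /d /dyadic {1}yE -addrA ltrD2l -mulrBr ltr_pM2l// -[X in _ - X]mul1r -mulrBl.
  by rewrite ltr_pM2r ?invr_gt0// ltrBlDr natr1.
- by rewrite yE /d /dyadic lerD2l ler_pM2l// ler_pM2r ?invr_gt0.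
Qed.

End Dyadic.

(** * Betti numbers of a single path *)

Section Path.
Variables (R : realType) (a b : R) (M : nat) (x : nat -> R).
Hypothesis xgrid : is_grid a b M x.
Hypothesis M0 : (0 < M)%N.

Definition sample_points (k : nat) : set R := dyadics (x k) (x k.+1 - x k).

Definition all_samples : set R :=
  \bigcup_(k in [set k | (k < M)%N]) sample_points k.

(** The pattern + - +, or - + - for [s = -1], on some dyadic subinterval.
    Zeros count as both signs, as in the definition of [crossover_prob]. *)
Definition double_crossover (f : R -> R) (k : nat) : Prop :=
  exists n j s, [/\ (j < 2 ^ n)%N, s = 1 \/ s = -1 &
    let d := dyadic (x k) (x k.+1 - x k) in
    [/\ 0 <= s * f (d n j), s * f (d n.+1 j.*2.+1) <= 0
      & 0 <= s * f (d n j.+1)]].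

Let width_gt0 k : (k < M)%N -> 0 < x k.+1 - x k.
Proof. by move=> kM; rewrite subr_gt0 (grid_lt xgrid)//; exact: ltnW. Qed.

Let cell k q : (k < M)%N -> sample_points k q -> x k <= q /\ q <= x k.+1.
Proof.
by move=> kM /(dyadics_bounds (width_gt0 kM)); rewrite addrC subrK.
Qed.

Lemma all_samples_in q : all_samples q -> q \in `[a, b].
Proof.
move=> [k kM /(cell kM)[kq qk]].
have := grid_in xgrid (ltnW kM); have := grid_in xgrid kM.
rewrite !in_itv/= => /andP[_ ?] /andP[? _]; apply/andP; split; lra.
Qed.

Lemma all_samples_dense y l r : y \in `[a, b] -> l < y -> y < r ->
  exists q, [/\ all_samples q, l < q & q < r].
Proof.
have [xa xb _] := xgrid.
rewrite in_itv/= => /andP[ay yb] ly yr.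
have [k [kM ky yk]] : exists k, [/\ (k < M)%N, x k <= y & y <= x k.+1].
  move: yb; rewrite le_eqVlt => /predU1P[yb|yb]; last first.
    by have [k [kM ky yk]] := grid_cell xgrid ay yb; exists k; rewrite ky ltW.
  exists M.-1; rewrite prednK// xb yb lexx -xb (grid_le xgrid)//; last exact: leq_pred.
  by rewrite leq_pred leqnn.
have [|q [Dq lq qy]] := dyadics_dense (width_gt0 kM) ly ky _.
  by rewrite addrC subrK.
by exists q; split; [exists k|by []|exact: le_lt_trans yr].
Qed.

Variables (u mu : R -> R) (s : R).
Let f q := u q - mu q.
Hypothesis fcont : {within `[a, b], continuous f}.
Hypothesis simple_zeros : ~ exists y, double_zero a b f y.
Hypothesis s1 : s = 1 \/ s = -1.

Definition sample_pos q := all_samples q /\ 0 < s * (u q - mu q).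
Definition sample_neg q := all_samples q /\ s * (u q - mu q) < 0.
(** Zeros belong to [grid_pos], since they belong to the threshold sets of
    [cubical_approx]. *)
Definition grid_pos q := exists k, [/\ (k <= M)%N, q = x k & 0 <= s * (u q - mu q)].
Definition grid_neg q := exists k, [/\ (k <= M)%N, q = x k & s * (u q - mu q) < 0].

Lemma nodal_domain_samples m :
  alternates m (nodal_domain a b u mu s) (~` nodal_domain a b u mu s) <->
  alternates m sample_pos sample_neg.
Proof.
have sf_cont : {within `[a, b], continuous (fun y => s * f y)}.
  by move=> y; apply: cvgM; [exact: cvg_cst|exact: fcont].
apply: (alternates_nodal sf_cont all_samples_in all_samples_dense).
move=> y l r yab sfy ly yr; have fy : f y = 0.
  by move: sfy; case: s1 => ->; rewrite ?mul1r// mulN1r => /eqP; rewrite oppr_eq0 => /eqP.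
have /(_ `]l, r[%classic) [|[p [lpr pab fp]] [q [lqr qab fq]]] :
    forall V, nbhs y V -> (exists z, [/\ V z, z \in `[a, b] & 0 < f z]) /\
                          (exists z, [/\ V z, z \in `[a, b] & f z < 0]).
  by apply: contrapT => dz; apply: simple_zeros; exists y.
- by apply: near_in_itvoo; rewrite in_itv/= ly yr.
case: s1 => ->.
  by exists p; move: lpr; rewrite /= in_itv/= mul1r => /andP[].
by exists q; move: lqr; rewrite /= in_itv/= mulN1r oppr_gt0 => /andP[].
Qed.

Lemma cubical_approx_grid m :
  alternates m (cubical_approx u mu M x s) (~` cubical_approx u mu M x s) <->
  alternates m grid_pos grid_neg.
Proof. exact: (alternates_cubical xgrid (fun q => s * (u q - mu q))). Qed.

Lemma samples_grid m : (forall q, all_samples q -> f q <> 0) ->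
  (forall k, (k < M)%N -> ~ double_crossover f k) ->
  alternates m sample_pos sample_neg <-> alternates m grid_pos grid_neg.
Proof.
move=> fN0 nocross.
apply: (@alternates_grid _ _ _ _ _ xgrid (fun q => s * (u q - mu q))
  sample_points m) => //.
- move=> k kM; have := dyadics_ends (x k) (x k.+1 - x k).
  by rewrite [x k + _]addrC subrK.
- move=> k q kM Dq; rewrite mulf_neq0//; last by apply/eqP/fN0; exists k.
  by case: s1 => ->; rewrite ?oppr_eq0 oner_eq0.
move=> k p q r kM.
apply: (@dyadics_convex _ _ _ (width_gt0 kM) (fun q => 0 < s * (u q - mu q))) => n j jn.
set d := dyadic _ _; have nocross_at t : t = 1 \/ t = -1 -> ~ [/\ 0 <= t * f (d n j),
    t * f (d n.+1 j.*2.+1) <= 0 & 0 <= t * f (d n j.+1)].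
  by move=> t1 H; apply: (nocross _ kM); exists n, j, t.
have := nocross_at s s1; have := nocross_at (- s).
rewrite -/(f (d n j)) -/(f (d n j.+1)) -/(f (d n.+1 j.*2.+1)).
have /[swap] /[apply] : - s = 1 \/ - s = -1.
  by case: s1 => ->; rewrite ?opprK; [right|left].
rewrite !mulNr !oppr_ge0 oppr_le0.
case: (ltP 0 (s * f (d n j))) => ?; case: (ltP 0 (s * f (d n j.+1))) => ?;
  case: (ltP 0 (s * f (d n.+1 _))) => ? // cross cross' _; exfalso.
  by apply: cross'; split=> //; exact: ltW.
by apply: cross; split=> //; exact: ltW.
Qed.

End Path.

(** * Measurability of alternation events *)

Section Measurability.
Context d (T : measurableType d) (R : realType).

(** Measurable and negligible sets are closed under unions of sequences; this
    reduction extends both closure properties to countable index sets. *)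
Lemma bigcup_countable_nat (I : Type) (D : set I) (F : I -> set T) :
  countable D -> exists2 G : nat -> set T,
    \bigcup_(i in D) F i = \bigcup_n G n &
    forall n, G n = set0 \/ exists2 i, D i & G n = F i.
Proof.
move=> cD; have [->|/set0P[r Dr]] := eqVneq D set0.
  by exists (fun=> set0); [rewrite bigcup_set0 bigcup0|left].
have /countable_injP[f injf] := cD.
exists (fun n => if n \in f @` D then F ('pinv_(cst r) D f n) else set0).
  by rewrite -bigcup_mkcond -[in LHS](injpinv_image (cst r) injf) bigcup_image.
move=> n; case: ifPn => [|_]; last by left.
by rewrite inE => -[i Di <-]; right; exists i; rewrite ?pinvKV ?inE.
Qed.

Lemma measurable_bigcup_countable (I : Type) (D : set I) (F : I -> set T) :
  countable D -> (forall i, D i -> measurable (F i)) ->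
  measurable (\bigcup_(i in D) F i).
Proof.
move=> /bigcup_countable_nat -/(_ F)[G -> GF] mF.
by apply: bigcupT_measurable => n; case: (GF n) => [->//|[i Di ->]]; exact: mF.
Qed.

Lemma negligible_bigcup_countable (mu : {measure set T -> \bar R})
    (I : Type) (D : set I) (F : I -> set T) :
  countable D -> (forall i, D i -> mu.-negligible (F i)) ->
  mu.-negligible (\bigcup_(i in D) F i).
Proof.
move=> /bigcup_countable_nat -/(_ F)[G -> GF] nF.
apply: negligible_bigcup => n; case: (GF n) => [->|[i Di ->]]; last exact: nF.
exact: negligible_set0.
Qed.

(** As [P] and [Q] are confined to the countable set [D], all quantifiers over
    points of the chain become countable unions. *)
Lemma measurable_alternates (D : set R) (P Q : T -> R -> Prop) m :
  countable D ->
  (forall w q, P w q -> D q) -> (forall w q, Q w q -> D q) ->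
  (forall q, measurable [set w | P w q]) ->
  (forall q, measurable [set w | Q w q]) ->
  measurable [set w | alternates m (P w) (Q w)].
Proof.
move=> cD PD QD mP mQ.
have m_from n q : measurable [set w | alternates_from n (P w) (Q w) q].
  elim: n q => [|n IH] q /=.
    by apply: measurableI (mP q) _; exact: measurableT.
  apply: measurableI (mP q) _.
  rewrite [X in measurable X](_ : _ = \bigcup_(y in D `&` [set y | q < y])
    \bigcup_(z in D `&` [set z | y < z]) ([set w | Q w y] `&`
      [set w | alternates_from n (P w) (Q w) z])).
    apply: measurable_bigcup_countable => [|y _].
      by apply: sub_countable cD; apply: subset_card_le; exact: subIsetl.
    apply: measurable_bigcup_countable => [|z _].
      by apply: sub_countable cD; apply: subset_card_le; exact: subIsetl.
    exact: measurableI (mQ y) (IH z).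
  apply/seteqP; split=> w /=.
    move=> [y [z [qy yz Qy chain]]]; exists y; first by split=> //; exact: QD Qy.
    by exists z => //; split=> //; exact: PD (alternates_from_head chain).
  by move=> [y [_ qy] [z [_ yz] [Qy chain]]]; exists y, z.
rewrite [X in measurable X](_ : _ = \bigcup_(q in D)
    [set w | alternates_from m (P w) (Q w) q]).
  exact: measurable_bigcup_countable.
apply/seteqP; split=> w /= [q]; last by move=> _; exists q.
by move=> chain; exists q => //; exact: PD (alternates_from_head chain).
Qed.

Lemma measurable_iff (A B : T -> Prop) : measurable [set w | A w] ->
  measurable [set w | B w] -> measurable [set w | A w <-> B w].
Proof.
move=> mA mB.
rewrite [X in measurable X](_ : _ = ([set w | A w] `&` [set w | B w]) `|`
   (~` [set w | A w] `&` ~` [set w | B w])).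
  by apply: measurableU; apply: measurableI => //; exact: measurableC.
apply/seteqP; split=> w /=; last by case=> -[]; split.
by have [Aw|NAw] := pselect (A w); [left; tauto|right; tauto].
Qed.

Lemma measurable_and (A : Prop) (F : T -> Prop) :
  (A -> measurable [set w | F w]) -> measurable [set w | A /\ F w].
Proof.
move=> mF; have [HA|NA] := pselect A.
  rewrite [X in measurable X](_ : _ = [set w | F w]); first exact: mF.
  by apply/seteqP; split=> w /= => [[]|].
rewrite [X in measurable X](_ : _ = set0)//.
by apply/seteqP; split=> w //= [].
Qed.

End Measurability.

(** * The probability of a double crossover in one cell *)

Section CrossoverProbability.
Context d (T : measurableType d) (R : realType) (P : probability T R).
Variables (a b : R) (u : R -> T -> R) (mu : R -> R) (x : nat -> R) (k : nat).
Hypothesis hu : random_field a b u.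
Let h := x k.+1 - x k.
Hypothesis h0 : 0 < h.
Hypothesis xkab : x k \in `[a, b].
Hypothesis xSkab : x k.+1 \in `[a, b].

Let event (s q delta : R) : set T :=
  [set w | [/\ s * mu q <= s * u q w,
               s * u (q + delta / 2) w <= s * mu (q + delta / 2)
             & s * mu (q + delta) <= s * u (q + delta) w]].

Let event_measurable s q delta : q \in `[a, b] -> q + delta / 2 \in `[a, b] ->
  q + delta \in `[a, b] -> measurable (event s q delta).
Proof.
move=> qab mab eab.
have mge y : y \in `[a, b] -> measurable [set w | s * mu y <= s * u y w].
  move=> yab; rewrite -[X in measurable X]setTI; apply: measurable_fun_le => //.
  by apply: measurable_funM => //; exact: hu.
have mle y : y \in `[a, b] -> measurable [set w | s * u y w <= s * mu y].
  move=> yab; rewrite -[X in measurable X]setTI; apply: measurable_fun_le => //.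
  by apply: measurable_funM => //; exact: hu.
rewrite [event _ _ _](_ : _ = [set w | s * mu q <= s * u q w] `&`
  [set w | s * u (q + delta / 2) w <= s * mu (q + delta / 2)] `&`
  [set w | s * mu (q + delta) <= s * u (q + delta) w]).
  by apply: measurableI; [apply: measurableI|]; [exact: mge|exact: mle|exact: mge].
by apply/seteqP; split=> w /=; [case|case=> -[]].
Qed.

Let crossing (n j : nat) : set T :=
  event 1 (dyadic (x k) h n j) (h / 2 ^+ n) `|`
  event (-1) (dyadic (x k) h n j) (h / 2 ^+ n).

Let crossing_level (n : nat) : set T :=
  \bigcup_(j in [set j | (j < 2 ^ n)%N]) crossing n j.

Let dyadic_cell n j : (j <= 2 ^ n)%N ->
  x k <= dyadic (x k) h n j /\ dyadic (x k) h n j <= x k.+1.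
Proof.
move=> jn; have : dyadics (x k) h (dyadic (x k) h n j) by exists n, j.
by move=> /(dyadics_bounds h0); rewrite {4}/h [x k + _]addrC subrK.
Qed.

Let dyadic_in n j : (j <= 2 ^ n)%N -> dyadic (x k) h n j \in `[a, b].
Proof.
by move=> /dyadic_cell; move: xkab xSkab; rewrite !in_itv/=; lra.
Qed.

Let dyadic_mid n j :
  dyadic (x k) h n j + h / 2 ^+ n / 2 = dyadic (x k) h n.+1 j.*2.+1.
Proof.
rewrite /dyadic -addrA; congr (_ + _); rewrite -(natr1 j.*2) -muln2 natrM exprSr.
by field; rewrite expf_neq0.
Qed.

Let dyadic_next n j : dyadic (x k) h n j + h / 2 ^+ n = dyadic (x k) h n j.+1.
Proof.
rewrite /dyadic -addrA; congr (_ + _); rewrite -(natr1 j).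
by field; rewrite expf_neq0.
Qed.

Lemma double_crossoverE :
  [set w | double_crossover x (fun q => u q w - mu q) k] =
  \bigcup_n crossing_level n.
Proof.
apply/seteqP; split=> w /=.
  move=> [n [j [s [jn s1 /=[]]]]]; rewrite -/h !mulrBr !subr_ge0 subr_le0.
  move=> ge1 le2 ge3; exists n => //; exists j => //.
  by case: s1 ge1 le2 ge3 => -> ? ? ?; [left|right];
    rewrite /event/= dyadic_mid dyadic_next.
move=> [n _ [j jn [[]|[]]]]; rewrite dyadic_mid dyadic_next => ge1 le2 ge3.
  by exists n, j, 1; split; [by []|by left|]; rewrite /= -/h !mulrBr !subr_ge0 subr_le0.
by exists n, j, (-1); split; [by []|by right|]; rewrite /= -/h !mulrBr !subr_ge0 subr_le0.
Qed.

Let crossing_measurable n j : (j < 2 ^ n)%N -> measurable (crossing n j).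
Proof.
move=> jn; have ? := dyadic_in (ltnW jn).
have ? : dyadic (x k) h n j + h / 2 ^+ n / 2 \in `[a, b].
  rewrite dyadic_mid dyadic_in// expnS; lia.
have ? : dyadic (x k) h n j + h / 2 ^+ n \in `[a, b].
  by rewrite dyadic_next dyadic_in.
by apply: measurableU; exact: event_measurable.
Qed.

Let crossing_level_measurable n : measurable (crossing_level n).
Proof. by apply: bigcup_measurable => j /= jn; exact: crossing_measurable. Qed.

Lemma measurable_double_crossover :
  measurable [set w | double_crossover x (fun q => u q w - mu q) k].
Proof.
by rewrite double_crossoverE; apply: bigcup_measurable => n _;
  exact: crossing_level_measurable.
Qed.

Variable c : R.
Hypothesis crossover_le : forall q delta, x k <= q -> 0 < delta -> delta <= h ->
  q + delta <= x k.+1 ->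
  (crossover_prob P u mu 1 q delta + crossover_prob P u mu (-1) q delta
     <= (c * delta ^+ 3)%:E)%E.

Let crossing_le n j : (j < 2 ^ n)%N ->
  (P (crossing n j) <= (c * (h / 2 ^+ n) ^+ 3)%:E)%E.
Proof.
move=> jn; have jab := dyadic_in (ltnW jn).
have mab : dyadic (x k) h n j + h / 2 ^+ n / 2 \in `[a, b].
  rewrite dyadic_mid dyadic_in// expnS; lia.
have nab : dyadic (x k) h n j + h / 2 ^+ n \in `[a, b].
  by rewrite dyadic_next dyadic_in.
apply: (le_trans (measureU2 _ _ _)); [exact: event_measurable|exact: event_measurable|].
have pow0 : 0 < 2 ^+ n :> R by rewrite exprn_gt0.
apply: crossover_le.
- by have [] := dyadic_cell (ltnW jn).
- by rewrite divr_gt0.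
- by rewrite ler_pdivrMr// ler_peMr ?(ltW h0)// exprn_ege1// ler1n.
- by rewrite dyadic_next; have [] := dyadic_cell jn.
Qed.

Let crossing_level_le n : (P (crossing_level n) <= (c * h ^+ 3 * 4^-1 ^+ n)%:E)%E.
Proof.
rewrite /crossing_level bigcup_mkord.
apply: (le_trans (Boole_inequality _ _)) => [j jn|]; first exact: crossing_measurable.
apply: (@le_trans _ _ (\sum_(j < 2 ^ n) (c * (h / 2 ^+ n) ^+ 3)%:E)%E).
  by apply: lee_sum => j _; exact: crossing_le.
rewrite sumEFin lee_fin sumr_const card_ord.
suff <- : c * (h / 2 ^+ n) ^+ 3 * 2 ^+ n = c * h ^+ 3 * 4^-1 ^+ n.
  by rewrite -natrX mulr_natr.
have -> : 4^-1 = 2^-1 ^+ 2 :> R by field.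
rewrite -exprM mulnC exprM exprVn.
by field; rewrite expf_neq0.
Qed.

(** Level [n] consists of [2 ^ n] intervals of length [h / 2 ^ n], so it
    contributes at most [c * h ^ 3 / 4 ^ n]; the geometric series produces the
    factor [4 / 3]. *)
Lemma double_crossover_prob : 0 <= c ->
  (P [set w | double_crossover x (fun q => u q w - mu q)%R k]
     <= (4 / 3 * (c * h ^+ 3))%:E)%E.
Proof.
move=> c0; rewrite double_crossoverE.
apply: (le_trans (generalized_Boole_inequality _ _ _)).
- by move=> n; exact: crossing_level_measurable.
- by apply: bigcup_measurable => n _; exact: crossing_level_measurable.
apply: lime_le; first exact: is_cvg_nneseries.
apply: nearW => N.
apply: (@le_trans _ _ (\sum_(0 <= n < N) (c * h ^+ 3 * 4^-1 ^+ n)%:E)%E).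
  by apply: lee_sum => n _; exact: crossing_level_le.
rewrite sumEFin lee_fin -mulr_sumr.
have ch0 : 0 <= c * h ^+ 3 by rewrite mulr_ge0// exprn_ge0// ltW.
rewrite mulrC ler_wpM2r//.
suff -> : \sum_(0 <= n < N) 4^-1 ^+ n = 4 / 3 * (1 - 4^-1 ^+ N) :> R.
  have : 0 <= 4^-1 ^+ N :> R by rewrite exprn_ge0.
  lra.
elim: N => [|N IH]; first by rewrite big_geq// expr0 subrr mulr0.
by rewrite big_nat_recr//= IH exprS; field.
Qed.

End CrossoverProbability.

(** * Lipschitz bounds and integrals of cube roots *)

Section Lipschitz.
Variables (R : realType) (a b : R) (f f' : R -> R).
Hypothesis ab : a < b.
Hypothesis f'cont : {within `[a, b], continuous f'}.
Hypothesis quotient : forall x, x \in `[a, b] ->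
  (f y - f x) / (y - x) @[y --> within `[a, b]%classic (x^')] --> f' x.

Let quotient_near x e : x \in `[a, b] -> 0 < e ->
  exists2 r, 0 < r & forall y, y \in `[a, b] -> `|x - y| < r -> y != x ->
    `|f' x - (f y - f x) / (y - x)| < e.
Proof.
move=> xab e0; have /cvgrPdist_lt /(_ _ e0) := quotient xab.
rewrite near_withinE /= => /nbhs_ballP[r /= r0 Hr]; exists r => // y yab yr yx.
exact: Hr.
Qed.

Lemma difference_quotient_continuous : {within `[a, b], continuous f}.
Proof.
apply/subspace_continuousP => x xab; apply/cvgrPdist_lt => e e0.
have [r r0 Hr] := quotient_near xab ltr01.
pose K := `|f' x| + 1; have K0 : 0 < K by rewrite ltr_wpDl.
rewrite near_withinE; apply/nbhs_ballP; exists (Num.min r (e / K)) => /=.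
  by rewrite lt_min r0 divr_gt0.
move=> y /= yr yab; rewrite /ball/= lt_min in yr.
have [->|yx] := eqVneq y x; first by rewrite subrr normr0.
move: yr => /andP[yr yK]; have := Hr y yab yr yx => Hq.
have yx0 : y - x != 0 by rewrite subr_eq0.
rewrite distrC -[f y - f x](divfK yx0) normrM.
have qK : `|(f y - f x) / (y - x)| <= K.
  have := ler_normB (f' x) (f' x - (f y - f x) / (y - x)).
  by rewrite opprB addrCA subrr addr0 => /le_trans; apply; rewrite lerD2l ltW.
apply: (le_lt_trans (ler_wpM2r (normr_ge0 _) qK)).
by rewrite distrC mulrC -ltr_pdivlMr.
Qed.

Let is_derive_quotient x : x \in `]a, b[ -> is_derive x 1 f (f' x).
Proof.
rewrite in_itv/= => /andP[ax xb].
have xab : x \in `[a, b] by rewrite in_itv/= !ltW.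
suff cvgD : h^-1 *: (f (h *: 1 + x) - f x) @[h --> 0^'] --> f' x.
  by apply: DeriveDef; [apply/cvg_ex; exists (f' x)|exact/cvg_lim].
apply/cvgrPdist_lt => e e0; have [r r0 Hr] := quotient_near xab e0.
rewrite near_withinE; apply/nbhs_ballP.
exists (Num.min r (Num.min (x - a) (b - x))) => /=.
  by rewrite !lt_min r0 !subr_gt0 ax xb.
move=> h; rewrite /ball/= sub0r normrN !lt_min => /andP[hr /andP[hxa hbx]] h0.
move: hxa hbx; rewrite !(ltr_norml h) => /andP[? ?] /andP[? ?].
have -> : h *: (1 : R) + x = x + h.
  by rewrite /GRing.scale/= mulr1 addrC.
have xhx : x + h - x = h by ring.
have xxh : x - (x + h) = - h by ring.
have := Hr (x + h); rewrite xhx xxh normrN /GRing.scale/= [h^-1 * _]mulrC.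
apply=> //; first by rewrite in_itv/=; lra.
by rewrite -subr_eq0 xhx.
Qed.

(** The derivative is bounded on [[a, b]] by compactness, and its bound
    controls the increments by the mean value theorem. *)
Lemma difference_quotient_lipschitz :
  exists2 L, 0 <= L & forall x y, x \in `[a, b] -> y \in `[a, b] -> x <= y ->
    `|f y - f x| <= L * (y - x).
Proof.
have f'Ncont : {within `[a, b], continuous (fun y => - f' y)}.
  by move=> y; apply: continuousN; exact: f'cont.
have [c1 _ max1] := EVT_max (ltW ab) f'cont.
have [c2 _ max2] := EVT_max (ltW ab) f'Ncont.
exists (`|f' c1| + `|f' c2|) => [|x y xab yab xy]; first by rewrite addr_ge0.
have sub t : t \in `[x, y] -> t \in `[a, b].
  by move: xab yab; rewrite !in_itv/=; lra.
have subo t : t \in `]x, y[ -> t \in `]a, b[.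
  by move: xab yab; rewrite !in_itv/=; lra.
have fcont : {within `[x, y], continuous f}.
  apply: (continuous_subspaceW _ difference_quotient_continuous) => t /=.
  exact: sub.
have [t txy ->] := MVT_segment xy (fun t txy => is_derive_quotient (subo t txy)) fcont.
rewrite normrM [X in _ * X]ger0_norm ?subr_ge0// ler_wpM2r ?subr_ge0//.
have := max1 _ (sub _ txy); have := max2 _ (sub _ txy).
have := ler_norm (f' c1); have := ler_norm (- f' c2); rewrite normrN.
by have := normr_ge0 (f' c1); have := normr_ge0 (f' c2); rewrite ler_norml; lra.
Qed.

End Lipschitz.

Section CubeRootIntegral.
Variables (R : realType) (a b : R) (C0 : R -> R).
Hypothesis C0cont : {within `[a, b], continuous C0}.
Hypothesis C0pos : forall x, x \in `[a, b] -> 0 < C0 x.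

Lemma cbrt_integral_ge p q c : a <= p -> p <= q -> q <= b -> 0 <= c ->
  (forall y, y \in `[p, q] -> c <= C0 y) ->
  c `^ 3^-1 * (q - p) <= cbrt_integral C0 p q.
Proof.
move=> ap pq qb c0 cC0.
have sub y : y \in `[p, q] -> y \in `[a, b] by rewrite !in_itv/=; lra.
have rcont : {within `[p, q], continuous (fun y => C0 y `^ 3^-1)}.
  apply: (@continuous_subspaceW _ _ _ `[a, b]); first by move=> y /=; exact: sub.
  apply/subspace_continuousP => y yab.
    apply: (@continuous_cvg R R R _ _ C0 (fun z => z `^ 3^-1) (C0 y)); last first.
    by move/subspace_continuousP : C0cont; exact.
  apply: differentiable_continuous; apply/derivable1_diffP.
  by apply: derivable_powR; rewrite in_itv/= andbT; exact: C0pos.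
have -> : c `^ 3^-1 * (q - p) =
    \int[@lebesgue_measure R]_(y in `[p, q]) (c `^ 3^-1).
  rewrite Rintegral_cst//= lebesgue_measure_itv/= lte_fin.
  case: ltP => pq'; first by rewrite -EFinD.
  have -> : p = q by apply/le_anti; rewrite pq pq'.
  by rewrite subrr !mulr0.
apply: le_Rintegral => //.
- apply: continuous_compact_integrable; first exact: segment_compact.
  by move=> y; exact: cvg_cst.
- by apply: continuous_compact_integrable; first exact: segment_compact.
- move=> y ypq; apply: ge0_ler_powR => //.
  by rewrite nnegrE ltW// C0pos// sub.
  exact: cC0.
Qed.

(** For [c >= 0] this is the cube of the previous estimate; for [c < 0] the
    left side is nonpositive. Allowing all signs of [c] makes the lemma applicable
    to the lower bound [C0 p - L * (q - p)] on long intervals. *)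
Lemma cbrt_integral_ge_cube p q c : a <= p -> p <= q -> q <= b ->
  (forall y, y \in `[p, q] -> c <= C0 y) ->
  c * (q - p) ^+ 3 <= cbrt_integral C0 p q ^+ 3.
Proof.
move=> ap pq qb cC0; have qp0 : 0 <= q - p by rewrite subr_ge0.
have I0 : 0 <= cbrt_integral C0 p q.
  by apply: Rintegral_ge0 => y _; exact: powR_ge0.
have [c0|c0] := leP 0 c; last first.
  by apply: (@le_trans _ _ 0); rewrite ?exprn_ge0// nmulr_rle0 ?exprn_ge0.
have := cbrt_integral_ge ap pq qb c0 cC0.
rewrite -[leLHS]ger0_norm ?mulr_ge0 ?powR_ge0// -(ger0_norm I0).
move=> /(lerXn2r 3); rewrite !nnegrE !normr_ge0 => /(_ isT isT).
rewrite !ger0_norm ?mulr_ge0 ?powR_ge0// exprMn.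
have -> // : (c `^ 3^-1) ^+ 3 = c.
by rewrite -powR_mulrn ?powR_ge0// -powRrM mulVf// powRr1.
Qed.

End CubeRootIntegral.

(** * Cells of an equidistributing grid *)

Section Equidistribution.
Variables (R : realType) (a b : R) (C0 : R -> R) (C1 : R).
Hypothesis ab : a < b.
Hypothesis hC0 : continuously_differentiable_on a b C0.
Hypothesis C0pos : forall x, x \in `[a, b] -> 0 < C0 x.
Hypothesis C1pos : 0 < C1.
Let I := cbrt_integral C0 a b.

(** The last estimate splits [C0 p + (L + C1) * h], with [h = q - p], into
    [C0 p - L * h], which bounds [C0] from below on the cell and is controlled
    by the integral, and [(2 * L + C1) * h]. The latter yields a term of order
    [h ^ 4], where [h <= I / (m * M)] for [m] the minimum of the cube root of
    [C0]. *)
Lemma cell_estimates : exists L K : R,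
  [/\ 0 <= L, 0 <= K,
      forall q y, q \in `[a, b] -> y \in `[a, b] -> q <= y -> C0 y <= C0 q + L * (y - q) &
      forall (M : nat) p q, (0 < M)%N -> a <= p -> p <= q -> q <= b ->
        cbrt_integral C0 p q = M%:R^-1 * I ->
        (C0 p + (L + C1) * (q - p)) * (q - p) ^+ 3
          <= I ^+ 3 / M%:R ^+ 3 + K / M%:R ^+ 4].
Proof.
have [C0' [C0'cont C0quot]] := hC0.
have C0cont := difference_quotient_continuous C0quot.
have [L L0 lip] := difference_quotient_lipschitz ab C0'cont C0quot.
have [z zab zmin] := EVT_min (ltW ab) C0cont.
pose m := C0 z `^ 3^-1; have m0 : 0 < m by rewrite powR_gt0// C0pos.
exists L, ((2 * L + C1) * (I / m) ^+ 4); split=> //.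
- by apply: mulr_ge0; [have := C1pos; lra|exact: exprn_even_ge0].
- move=> q y qab yab qy; have := lip q y qab yab qy.
  by rewrite ler_norml => /andP[_]; lra.
move=> M p q M0 ap pq qb Ipq.
have h0 : 0 <= q - p by rewrite subr_ge0.
have sub y : y \in `[p, q] -> y \in `[a, b] by rewrite !in_itv/=; lra.
have cube : (C0 p - L * (q - p)) * (q - p) ^+ 3 <= I ^+ 3 / M%:R ^+ 3.
  have := @cbrt_integral_ge_cube _ a b C0 C0cont C0pos p q (C0 p - L * (q - p)) ap pq qb.
  rewrite Ipq exprMn exprVn mulrC [_^-1 * _]mulrC mulrC; apply=> y ypq.
  have pab : p \in `[a, b] by rewrite in_itv/= ap (le_trans pq).
  move: (ypq); rewrite in_itv/= => /andP[py yq].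
  have := lip p y pab (sub _ ypq) py; rewrite ler_norml => /andP[+ _].
  have : L * (y - p) <= L * (q - p) by rewrite ler_wpM2l// lerD2r.
  lra.
have width : q - p <= I / m / M%:R.
  rewrite mulrAC ler_pdivlMr// mulrC [I / _]mulrC -Ipq.
  apply: cbrt_integral_ge => //; first by rewrite ltW// C0pos.
  by move=> y ypq; apply: zmin; exact: sub.
have fourth : (q - p) ^+ 4 <= (I / m) ^+ 4 / M%:R ^+ 4.
  by rewrite -expr_div_n lerXn2r// nnegrE; exact: le_trans width.
have -> : (C0 p + (L + C1) * (q - p)) * (q - p) ^+ 3 =
  (C0 p - L * (q - p)) * (q - p) ^+ 3 + (2 * L + C1) * (q - p) ^+ 4 by ring.
by rewrite lerD// -mulrA ler_wpM2l//; have := C1pos; lra.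
Qed.

End Equidistribution.

Section CompletedProbability.
Context d (T : measurableType d) (R : realType) (P : probability T R).

Lemma has_completed_prob0 (A : set T) :
  has_completed_prob P A 0%E -> P.-negligible A.
Proof.
move=> [B [mB nAB PB]].
apply: (@negligibleS _ _ _ _ ((A `+` B) `|` B)); last first.
  by apply: negligibleU nAB _; exact/negligibleP.
by move=> w Aw; have [Bw|NBw] := pselect (B w); [right|left; left].
Qed.

(** An event which agrees with a measurable set [B] outside a null set is an
    event of the completion, with the probability of [B]. *)
Lemma has_completed_prob_ge (E B bad N : set T) (e : R) :
  measurable B -> measurable bad -> P.-negligible N ->
  (forall w, ~ N w -> E w <-> B w) ->
  (forall w, ~ N w -> ~ bad w -> B w) ->
  (P bad <= e%:E)%E ->
  exists2 p, has_completed_prob P E p & ((1 - e)%:E <= p)%E.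
Proof.
move=> mB mbad negN EB goodB Pbad; exists (P B).
  exists B; split=> //; apply: negligibleS negN => w [[Ew NBw]|[Bw NEw]];
  by apply: contrapT => /EB [? ?]; tauto.
have [N' [mN' N'0 NN']] := negN.
have PBC : (P (~` B) <= e%:E)%E.
  apply: (@le_trans _ _ (P (bad `|` N'))).
    apply: le_measure; rewrite ?inE.
    - exact: measurableC.
    - exact: measurableU.
    move=> w NBw; apply: contrapT => /not_orP[nbad nN']; apply: NBw.
    by apply: goodB => // /NN'.
  by apply: (le_trans (measureU2 _ mbad mN')); rewrite [X in (_ + X)%E]N'0 adde0.
have -> : P B = (1 - P (~` B))%E.
  by rewrite -probability_setC ?setCK//; exact: measurableC.
by rewrite EFinB leeB.
Qed.

End CompletedProbability.

(** * The event of equal Betti numbers *)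

Lemma countable_dyadics (R : realType) (p h : R) : countable (dyadics p h).
Proof.
apply: (@sub_countable _ _ _ ((fun nj : nat * nat => dyadic p h nj.1 nj.2) @` setT)).
  by apply: subset_card_le => q [n [j [_ ->]]]; exists (n, j).
exact: sub_countable (card_image_le _ _) (countableP _).
Qed.

Lemma countable_all_samples (R : realType) (M : nat) (x : nat -> R) :
  countable (all_samples M x).
Proof. by apply: bigcup_countable => // k _; exact: countable_dyadics. Qed.

Lemma countable_grid (R : realType) (M : nat) (x : nat -> R) :
  countable [set q | exists2 k, (k <= M)%N & q = x k].
Proof.
apply: (@sub_countable _ _ _ (x @` setT)); last first.
  exact: sub_countable (card_image_le _ _) (countableP _).
by apply: subset_card_le => q [k _ ->]; exists k.
Qed.

Section Agreement.
Context d (T : measurableType d) (R : realType).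
Variables (a b : R) (M : nat) (x : nat -> R).
Variables (u : R -> T -> R) (mu : R -> R).
Hypothesis hu : random_field a b u.
Hypothesis xgrid : is_grid a b M x.

Let agree (s : R) (m : nat) (w : T) :=
  alternates m (sample_pos M x (u^~ w) mu s) (sample_neg M x (u^~ w) mu s) <->
  alternates m (grid_pos M x (u^~ w) mu s) (grid_neg M x (u^~ w) mu s).

Lemma measurable_agree s m : measurable [set w | agree s m w].
Proof.
have m_ge0 q : q \in `[a, b] -> measurable [set w | 0 <= s * (u q w - mu q)].
  move=> qab; rewrite -[X in measurable X]setTI; apply: measurable_fun_le => //.
  by apply: measurable_funM => //; apply: measurable_funB => //; exact: hu.
have m_le0 q : q \in `[a, b] -> measurable [set w | s * (u q w - mu q) <= 0].
  move=> qab; rewrite -[X in measurable X]setTI; apply: measurable_fun_le => //.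
  by apply: measurable_funM => //; apply: measurable_funB => //; exact: hu.
have m_gt0 q : q \in `[a, b] -> measurable [set w | 0 < s * (u q w - mu q)].
  move=> qab; rewrite [X in measurable X](_ : _ = ~` [set w | s * (u q w - mu q) <= 0]).
    by apply: measurableC; exact: m_le0.
  by apply/seteqP; split=> w /=; rewrite ltNge => /negP.
have m_lt0 q : q \in `[a, b] -> measurable [set w | s * (u q w - mu q) < 0].
  move=> qab; rewrite [X in measurable X](_ : _ = ~` [set w | 0 <= s * (u q w - mu q)]).
    by apply: measurableC; exact: m_ge0.
  by apply/seteqP; split=> w /=; rewrite ltNge => /negP.
have grid_and F q : [set w | exists k, [/\ (k <= M)%N, q = x k & F w]] =
    [set w : T | (exists2 k, (k <= M)%N & q = x k) /\ F w].
  by apply/seteqP; split=> w /= => [[k [kM qk Fw]]|[[k kM qk] Fw]];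
    [split=> //; exists k|exists k].
apply: measurable_iff.
- apply: (measurable_alternates _ (countable_all_samples M x)); try by move=> ? ? [].
    by move=> q; apply: measurable_and => /(all_samples_in xgrid); exact: m_gt0.
  by move=> q; apply: measurable_and => /(all_samples_in xgrid); exact: m_lt0.
- apply: (measurable_alternates _ (countable_grid M x)).
  + by move=> w q [k [kM qk _]]; exists k.
  + by move=> w q [k [kM qk _]]; exists k.
  + move=> q; rewrite grid_and; apply: measurable_and => -[k kM ->].
    by apply: m_ge0; exact: (grid_in xgrid).
  + move=> q; rewrite grid_and; apply: measurable_and => -[k kM ->].
    by apply: m_lt0; exact: (grid_in xgrid).
Qed.

Lemma measurable_eq_level q : q \in `[a, b] -> measurable [set w | u q w = mu q].
Proof.
move=> qab.
have -> : [set w | u q w = mu q] = [set w | u q w <= mu q] `&` [set w | mu q <= u q w].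
  apply/seteqP; split=> w /= => [->|[le ge]]; first by rewrite lexx.
  by apply/le_anti; rewrite le ge.
by apply: measurableI; rewrite -[X in measurable X]setTI;
  apply: measurable_fun_le => //; exact: hu.
Qed.

(** The measurable version of the event of equal Betti numbers. *)
Definition samples_agree_grid (w : T) :=
  forall m, agree 1 m w /\ agree (-1) m w.

Lemma measurable_samples_agree_grid : measurable [set w | samples_agree_grid w].
Proof.
rewrite [X in measurable X](_ : _ = \bigcap_m ([set w | agree 1 m w] `&`
    [set w | agree (-1) m w])).
  by apply: bigcapT_measurable => m; apply: measurableI; exact: measurable_agree.
by apply/seteqP; split=> w /= => [H m _|H m]; [exact: H|exact: (H m I)].
Qed.

Hypothesis M0 : (0 < M)%N.

Lemma beta0_agree w :
  {within `[a, b], continuous (fun q => u q w - mu q)} ->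
  ~ (exists y, double_zero a b (fun q => u q w - mu q) y) ->
  (beta0 (nodal_domain a b (u^~ w) mu 1) = beta0 (cubical_approx (u^~ w) mu M x 1) /\
   beta0 (nodal_domain a b (u^~ w) mu (-1)) =
     beta0 (cubical_approx (u^~ w) mu M x (-1))) <->
  samples_agree_grid w.
Proof.
move=> cont nodouble.
have E s : s = 1 \/ s = -1 ->
    beta0 (nodal_domain a b (u^~ w) mu s) = beta0 (cubical_approx (u^~ w) mu M x s) <->
    forall m, agree s m w.
  move=> s1; rewrite beta0_eq /agree; split=> H m.
    by rewrite -(nodal_domain_samples xgrid M0 cont nodouble s1) H
      (cubical_approx_grid xgrid).
  by rewrite (nodal_domain_samples xgrid M0 cont nodouble s1) H
    (cubical_approx_grid xgrid).
rewrite (E 1 (or_introl erefl)) (E (-1) (or_intror erefl)).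
by split=> [[H1 H2] m|H]; [split|split=> m; case: (H m)].
Qed.

Lemma no_crossover_agree w :
  (forall q, all_samples M x q -> u q w <> mu q) ->
  (forall k, (k < M)%N -> ~ double_crossover x (fun q => u q w - mu q) k) ->
  samples_agree_grid w.
Proof.
move=> neq nocross m.
have neq0 q : all_samples M x q -> u q w - mu q <> 0.
  by move=> /neq qN /eqP; rewrite subr_eq0 => /eqP.
by split; apply: (samples_grid xgrid M0) => //; [left|right].
Qed.

End Agreement.

(** * Summation over the cells and conclusion *)

Section CrossoverOnGrid.
Context d (T : measurableType d) (R : realType) (P : probability T R).
Variables (a b : R) (mu : R -> R) (u : R -> T -> R) (C0 : R -> R) (C1 L K I : R).
Hypothesis hu : random_field a b u.
Hypothesis C0pos : forall x, x \in `[a, b] -> 0 < C0 x.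
Hypothesis C1pos : 0 < C1.
Hypothesis L0 : 0 <= L.
Hypothesis A3 : forall x delta : R,
  x \in `[a, b] -> 0 < delta -> x + delta \in `[a, b] ->
  (crossover_prob P u mu 1 x delta + crossover_prob P u mu (-1) x delta
     <= (C0 x * delta ^+ 3 + C1 * delta ^+ 4)%:E)%E.
Hypothesis C0lip : forall q y, q \in `[a, b] -> y \in `[a, b] -> q <= y ->
  C0 y <= C0 q + L * (y - q).
Variables (M : nat) (x : nat -> R).
Hypothesis M0 : (0 < M)%N.
Hypothesis xgrid : is_grid a b M x.
Hypothesis cells : forall k, (k < M)%N ->
  (C0 (x k) + (L + C1) * (x k.+1 - x k)) * (x k.+1 - x k) ^+ 3
    <= I ^+ 3 / M%:R ^+ 3 + K / M%:R ^+ 4.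

Let bad := \bigcup_(k in [set k | (k < M)%N])
  [set w | double_crossover x (fun q => u q w - mu q) k].

Let width_gt0 k : (k < M)%N -> 0 < x k.+1 - x k.
Proof. by move=> kM; rewrite subr_gt0 (grid_lt xgrid)//; exact: ltnW. Qed.

Let measurable_cell k : (k < M)%N ->
  measurable [set w | double_crossover x (fun q => u q w - mu q) k].
Proof.
move=> kM; apply: (measurable_double_crossover mu hu (width_gt0 kM)).
  by apply: (grid_in xgrid); exact: ltnW.
exact: (grid_in xgrid).
Qed.

Lemma measurable_some_crossover : measurable bad.
Proof. by apply: bigcup_measurable => k /= kM; exact: measurable_cell. Qed.

(** In a subinterval of length [delta <= h] of the cell [[x_k, x_k + h]], the
    bound of [A3] is at most [(C0 (x_k) + (L + C1) * h) * delta ^ 3], because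
    [C0] grows by at most [L * h] and [delta ^ 4 <= h * delta ^ 3]. *)
Lemma some_crossover_prob :
  (P bad <= (4 / (3 * M%:R ^+ 2) * I ^+ 3 + 4 / 3 * K * (M%:R ^+ 3)^-1)%:E)%E.
Proof.
have MR0 : M%:R != 0 :> R by rewrite pnatr_eq0 -lt0n.
rewrite /bad bigcup_mkord.
apply: (le_trans (@Boole_inequality _ _ _ P
  (fun k => [set w | double_crossover x (fun q => (u q w - mu q)%R) k]) M _)).
  by move=> k; exact: measurable_cell.
apply: (@le_trans _ _ (\sum_(k < M) (4 / 3 * (I ^+ 3 / M%:R ^+ 3 + K / M%:R ^+ 4))%:E)%E).
  apply: lee_sum => k _; have kM := ltn_ord k.
  have xk := grid_in xgrid (ltnW kM); have xk1 := grid_in xgrid kM.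
  have h0 := width_gt0 kM.
  have ck0 : 0 <= C0 (x k) + (L + C1) * (x k.+1 - x k).
    apply: addr_ge0 (ltW (C0pos xk)) (mulr_ge0 (addr_ge0 L0 (ltW C1pos)) (ltW h0)).
  apply: le_trans (double_crossover_prob hu h0 xk xk1 _ ck0) _; last first.
    by rewrite lee_fin ler_wpM2l//; exact: cells.
  move=> q delta xq delta0 delta_le q_le.
  have qab : q \in `[a, b].
    move: xk xk1; rewrite !in_itv/= => /andP[? ?] /andP[? ?].
    by apply/andP; split; lra.
  have q'ab : q + delta \in `[a, b].
    move: xk xk1; rewrite !in_itv/= => /andP[? ?] /andP[? ?].
    by apply/andP; split; lra.
  apply: (le_trans (A3 qab delta0 q'ab)); rewrite lee_fin.
  have -> : C0 q * delta ^+ 3 + C1 * delta ^+ 4 =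
    (C0 q + C1 * delta) * delta ^+ 3 by ring.
  rewrite ler_wpM2r ?exprn_ge0 ?(ltW delta0)//.
  have := C0lip xk qab xq.
  have : C1 * delta <= C1 * (x k.+1 - x k) by rewrite ler_pM2l.
  have : L * (q - x k) <= L * (x k.+1 - x k) by rewrite ler_wpM2l//; lra.
  lra.
rewrite sumEFin lee_fin sumr_const card_ord -[_ *+ M]mulr_natr.
rewrite le_eqVlt; apply/orP; left; apply/eqP; by field.
Qed.

End CrossoverOnGrid.

Theorem theorem1p2 (d : measure_display) (T : measurableType d) (R : realType)
  (P : probability T R) (a b : R) (hab : a < b)
  (mu : R -> R) (hmu : {within `[a, b], continuous mu})
  (u : R -> T -> R) (hu : random_field a b u)
  (hucont : {ae P, forall w, {within `[a, b], continuous (fun x => u x w)}})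
  (A1 : forall x, x \in `[a, b] -> P [set w | u x w = mu x] = 0%E)
  (A2 : has_completed_prob P
          [set w | exists x, double_zero a b (fun y => u y w - mu y) x] 0%E)
  (C0 : R -> R) (C1 : R)
  (hC0 : continuously_differentiable_on a b C0)
  (C0pos : forall x, x \in `[a, b] -> 0 < C0 x)
  (C1pos : 0 < C1)
  (A3 : forall x delta : R, x \in `[a, b] -> 0 < delta -> x + delta \in `[a, b] ->
     (crossover_prob P u mu 1 x delta + crossover_prob P u mu (-1) x delta
        <= (C0 x * delta ^+ 3 + C1 * delta ^+ 4)%:E)%E)
  (x : nat -> nat -> R)
  (hgrid : forall M : nat, (0 < M)%N -> is_grid a b M (x M))
  (hequi : forall M : nat, (0 < M)%N -> forall k : nat, (k < M)%N ->
     cbrt_integral C0 (x M k) (x M k.+1) = M%:R^-1 * cbrt_integral C0 a b) :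
  exists r : nat -> R,
    r =O_\oo (fun M : nat => (M%:R ^+ 3)^-1 : R^o) /\
    forall M : nat, (0 < M)%N ->
      exists2 p : \bar R,
        has_completed_prob P
          [set w |
             beta0 (nodal_domain a b (fun y => u y w) mu 1)
             = beta0 (cubical_approx (fun y => u y w) mu M (x M) 1) /\
             beta0 (nodal_domain a b (fun y => u y w) mu (-1))
             = beta0 (cubical_approx (fun y => u y w) mu M (x M) (-1))] p
        & ((1 - 4 / (3 * M%:R ^+ 2) * cbrt_integral C0 a b ^+ 3 + r M)%:E
             <= p)%E.
Proof.
have [L [K [L0 K0 C0lip cell]]] := cell_estimates hab hC0 C0pos C1pos.
exists (fun M => - (4 / 3 * K * (M%:R ^+ 3)^-1)); split.
  apply/eqO_exP; exists (4 / 3 * K + 1); first by rewrite ltr_wpDl// mulr_ge0.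
  apply: nearW => M; rewrite normrN normrM [X in X * _]ger0_norm ?mulr_ge0//.
  by rewrite ler_wpM2r// lerDl.
move=> M M0; have xgrid := hgrid M M0.
set I := cbrt_integral C0 a b.
have -> : 1 - 4 / (3 * M%:R ^+ 2) * I ^+ 3 - 4 / 3 * K * (M%:R ^+ 3)^-1
  = 1 - (4 / (3 * M%:R ^+ 2) * I ^+ 3 + 4 / 3 * K * (M%:R ^+ 3)^-1) by ring.
(* the null set outside of which paths are continuous, have no double zero and
   vanish at no dyadic point *)
pose N := ~` [set w | {within `[a, b], continuous (fun q => u q w)}]
  `|` [set w | exists q, double_zero a b (fun y => u y w - mu y) q]
  `|` \bigcup_(q in all_samples M (x M)) [set w | u q w = mu q].
have cells k : (k < M)%N ->
    (C0 (x M k) + (L + C1) * (x M k.+1 - x M k)) * (x M k.+1 - x M k) ^+ 3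
      <= I ^+ 3 / M%:R ^+ 3 + K / M%:R ^+ 4.
  move=> kM; have := grid_in xgrid (ltnW kM); have := grid_in xgrid kM.
  rewrite !in_itv/= => /andP[_ ?] /andP[? _].
  have xle : x M k <= x M k.+1 by rewrite (grid_le xgrid)//; exact: ltnW.
  exact: (cell M _ _ M0 _ xle _ (hequi M M0 k kM)).
apply: (@has_completed_prob_ge _ _ _ _ _
  [set w | samples_agree_grid M (x M) u mu w] _ N)
  (some_crossover_prob hu C0pos C1pos L0 A3 C0lip M0 xgrid cells).
- exact: (measurable_samples_agree_grid mu hu xgrid).
- exact: (measurable_some_crossover mu hu xgrid).
- apply: negligibleU; first apply: negligibleU.
  + exact: hucont.
  + exact: has_completed_prob0.
  + apply: negligible_bigcup_countable; first exact: countable_all_samples.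
    move=> q /(all_samples_in xgrid) qab.
    by apply/negligibleP; [exact: (measurable_eq_level mu hu)|exact: A1].
- move=> w /not_orP[/not_orP[/contrapT ucont nodouble] _] /=.
  apply: beta0_agree => //.
  by move=> q; apply: continuousB; [exact: ucont|exact: hmu].
- move=> w /not_orP[_ neq] nobad /=.
  apply: (no_crossover_agree xgrid M0) => [q Dq|k kM].
    by apply: contra_not neq => uq; exists q.
  by apply: contra_not nobad => cross; exists k.
Qed.
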